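(* Let $T_n$ be as defined in the context. For every integer $n>1$, $T_n$ is given by each of the following three formulas. (i) $$T_n = n!\cdot \sum_{j=0}^n (-1)^j\cdot (n-j)!\cdot [y^0z^j]\ \operatorname{tr}(B^{2n}),\qquad B= \begin{bmatrix} 0 & y^{-1} & 0 & y & 0 & 0\\ yz & 0 & y^{-1} & 0 & y & 0\\ yz & 0 & 0 & 0 & y & 0 \\ 0 & y^{-1} & 0 & 0 & 0 & y^{-1}z\\ 0 & y^{-1} & 0 & y & 0 & y^{-1}z\\ 0 & 0 & y^{-1} & 0 & y & 0 \end{bmatrix}.$$ (ii) $$T_n = n!\cdot\int_0^{\infty} [y^n]\ \operatorname{tr}(B_2^{n})\, e^{-t}\, dt,\qquad B_2 = \begin{bmatrix} -y& yt& t& 0& yt& -y \\ -y& y(t - 1)& 0& y^2(t - 1)& yt& -y \\ 0& y(t - 1)& 0& y^2(t - 1)& 0& -y \\ -y& 0& t - 1& 0& y(t - 1)& 0 \\ -y& yt& t - 1& 0& y(t - 1)& -y \\ -y& yt& 0& y^2t& yt& -y \end{bmatrix}.$$ (iii) $$T_n = n!\cdot\int_0^{\infty} [x^ny^n]\ \frac{a(xy,t) + b(xy,t)\cdot (x+xy^2)}{c(xy,t)+d(xy,t)\cdot (x+xy^2)}\, e^{-t}\, dt,$$ where $a(p,t) = -2p^{5}t^{3}+2p^{4}t^{4}+4p^{5}t^{2}-8p^{4}t^{3}-2p^{5}t+12p^{4}t^{2}-8p^{4}t+6p^{3}t-4p^{2}t^{2}+16p^{2}-10pt+20p+6$, $b(p,t)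 = -p^2t(2+p-t)(p-3t+6)$, $c(p,t) = p^{6}t^{2}-2p^{5}t^{3}+p^{4}t^{4}+4p^{5}t^{2}-4p^{4}t^{3}-2p^{5}t+6p^{4}t^{2}-4p^{4}t+2p^{3}t-p^{2}t^{2}+4p^{2}-2pt+4p+1$, $d(p,t) = -p^2t(2+p-t)^2$.
   Context: For $n\ge1$, $T_n$ is the number of ways to seat $n$ married couples (each couple consisting of one woman and one man) at $2n$ distinguishable seats arranged around a circular table so that no two spouses occupy adjacent seats and no three cyclically consecutive seats are occupied by people of the same sex. $[y^0z^j]\,P$ denotes the coefficient of $y^0z^j$ in a Laurent polynomial $P$; $[y^n]$ and $[x^ny^n]$ denote coefficient extraction (in (iii) the rational function is expanded as a formal power series in $x,y$, which is possible since $c(0,t)=1$; the extracted coefficients are polynomials in $t$). $\operatorname{tr}$ is the matrix trace. *)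

(* Defs.v *)
From HB Require Import structures.
From mathcomp Require Import all_boot all_order all_algebra.
From mathcomp Require Import all_classical all_reals all_analysis.
From mathcomp Require Import zify ring.

Set Implicit Arguments.
Unset Strict Implicit.
Unset Printing Implicit Defensive.

Import Order.TTheory GRing.Theory Num.Theory.

Local Open Scope ring_scope.

(* A person is a pair (couple, sex); the sex bit distinguishes the woman from
   the man of the couple. *)
Definition person (n : nat) := ('I_n * bool)%type.

Definition spouses (n : nat) (p q : person n) : bool :=
  (p.1 == q.1) && (p.2 != q.2).

(* [ordS] is the successor modulo 2n, i.e. the next seat around the table.
   Since there are as many seats as persons, an injective assignment of persons
   to seats is a bijection. *)
Definition admissible (n : nat) (s : {ffun 'I_(2 * n) -> person n}) : bool :=
  [&& injectiveb s,
      [forall i, ~~ spouses (s i) (s (ordS i))] &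
      [forall i, ~~ (((s i).2 == (s (ordS i)).2) &&
                     ((s (ordS i)).2 == (s (ordS (ordS i))).2))]].

Definition seatings (n : nat) : nat :=
  #|[set s : {ffun 'I_(2 * n) -> person n} | admissible s]|.

(* The Laurent polynomials A[y, y^-1] are seen inside the fraction field of
   A[y], as the f such that y^m f is a polynomial p for some m; the coefficient
   of y^k in f is then the coefficient of y^(m + k) in p. It does not depend on
   the choice of (m, p): see laurent_coefE. *)
Definition laurent_coef (A : idomainType) (k : int) (f : {fraction {poly A}}) : A :=
  let mp := xget (0%N, 0 : {poly A})
                 [set mp | f * tofrac 'X ^+ mp.1 = tofrac mp.2]%classic in
  if mp.1%:Z + k is Posz i then mp.2`_i else 0.

Lemma laurent_coefE (A : idomainType) (k : int) (f : {fraction {poly A}})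
    (m : nat) (p : {poly A}) :
  f * tofrac 'X ^+ m = tofrac p ->
  laurent_coef k f = if m%:Z + k is Posz i then p`_i else 0.
Proof.
move=> fp; rewrite /laurent_coef; set S := [set _ | _]%classic.
have /= := @xgetPex _ (0%N, 0 : {poly A}) S (ex_intro _ (m, p) fp).
case: (xget _ _) => m' p' /= fp'.
have pE : p * 'X^m' = p' * 'X^m.
  apply/eqP; rewrite -tofrac_eq !tofracM !tofracXn -fp -fp'.
  by rewrite mulrAC.
have coefE i i' : (i + m' = i' + m)%N -> p`_i = p'`_i'.
  move=> ii'.
  have := congr1 (fun q : {poly A} => q`_(i + m')) pE.
  by rewrite coefMXn ltnNge leq_addl /= addnK ii' coefMXn ltnNge leq_addl /= addnK.
have coef0 i : (i + m' < m)%N -> p`_i = 0.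
  move=> lt_im.
  have := congr1 (fun q : {poly A} => q`_(i + m')) pE.
  by rewrite coefMXn ltnNge leq_addl /= addnK coefMXn lt_im.
have coef0' i' : (i' + m < m')%N -> p'`_i' = 0.
  move=> lt_im.
  have := congr1 (fun q : {poly A} => q`_(i' + m)) pE.
  by rewrite coefMXn lt_im coefMXn ltnNge leq_addl /= addnK.
case E' : (m'%:Z + k) => [i'|i']; case E : (m%:Z + k) => [i|i] //.
- by apply/esym/coefE; lia.
- by apply: coef0'; lia.
- by apply/esym/coef0; lia.
Qed.

Record fps (A : Type) := Fps { fps_coef :> nat -> A }.

HB.instance Definition _ (A : Type) := [isNew for (@fps_coef A)].
HB.instance Definition _ (A : choiceType) := [Choice of fps A by <:].

Section FpsRing.
Variable A : comNzRingType.
Implicit Types f g h : fps A.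

Lemma fpsP f g : (forall n, f n = g n) -> f = g.
Proof. by case: f g => [f] [g] /= fg; congr Fps; apply/funext. Qed.

Definition fps_add f g := Fps (fun n => f n + g n).
Definition fps_opp f := Fps (fun n => - f n).
Definition fpsC (a : A) := Fps (fun n => if n is 0%N then a else 0).
Definition fps_mul f g := Fps (fun n => \sum_(i < n.+1) f i * g (n - i)%N).

Lemma fps_addA : associative fps_add.
Proof. by move=> f g h; apply: fpsP => n /=; rewrite addrA. Qed.
Lemma fps_addC : commutative fps_add.
Proof. by move=> f g; apply: fpsP => n /=; rewrite addrC. Qed.
Lemma fps_add0 : left_id (fpsC 0) fps_add.
Proof. by move=> f; apply: fpsP => -[|n] /=; rewrite add0r. Qed.
Lemma fps_addN : left_inverse (fpsC 0) fps_opp fps_add.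
Proof. by move=> f; apply: fpsP => -[|n] /=; rewrite addNr. Qed.

HB.instance Definition _ :=
  GRing.isZmodule.Build (fps A) fps_addA fps_addC fps_add0 fps_addN.

Let trunc n f := \poly_(i < n.+1) f i.

Let coef_trunc n f i : (i <= n)%N -> (trunc n f)`_i = f i.
Proof. by move=> le_in; rewrite coef_poly ltnS le_in. Qed.

Let fps_mulE n f g i : (i <= n)%N -> fps_mul f g i = (trunc n f * trunc n g)`_i.
Proof.
move=> le_in; rewrite coefM /=; apply: eq_bigr => j _.
by rewrite !coef_trunc // (leq_trans _ le_in) ?leq_subr // -ltnS.
Qed.

Lemma fps_mulC : commutative fps_mul.
Proof. by move=> f g; apply: fpsP => n; rewrite !(@fps_mulE n) // mulrC. Qed.

Lemma fps_mulA : associative fps_mul.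
Proof.
move=> f g h; apply: fpsP => n.
transitivity (trunc n f * trunc n g * trunc n h)`_n.
  rewrite -mulrA coefM; apply: eq_bigr => j _.
  have le_jn : (j <= n)%N by rewrite -ltnS.
  by rewrite (coef_trunc f le_jn) (fps_mulE g h (leq_subr j n)).
rewrite coefM; apply: eq_bigr => j _.
have le_jn : (j <= n)%N by rewrite -ltnS.
by rewrite (fps_mulE f g le_jn) (coef_trunc h (leq_subr j n)).
Qed.

Lemma fps_mul1 : left_id (fpsC 1) fps_mul.
Proof.
move=> f; apply: fpsP => n /=; rewrite big_ord_recl /= mul1r subn0.
by rewrite big1 ?addr0 // => i _; rewrite mul0r.
Qed.

Lemma fps_mulDl : left_distributive fps_mul fps_add.
Proof.
move=> f g h; apply: fpsP => n /=; rewrite -big_split /=.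
by apply: eq_bigr => i _; rewrite mulrDl.
Qed.

Lemma fps_1neq0 : fpsC 1 != 0 :> fps A.
Proof.
apply/eqP => /(congr1 (fun f => fps_coef f 0%N)) /= /eqP.
by rewrite oner_eq0.
Qed.

HB.instance Definition _ := GRing.Zmodule_isComNzRing.Build (fps A)
  fps_mulA fps_mulC fps_mul1 fps_mulDl fps_1neq0.

Definition fpsX : fps A := Fps (fun n => (n == 1%N)%:R).

Definition fps_coef0 f : A := f 0%N.

Lemma fps_coef0_zmod_morphism : zmod_morphism fps_coef0.
Proof. by []. Qed.
Lemma fps_coef0_monoid_morphism : monoid_morphism fps_coef0.
Proof. by split=> // f g; rewrite /fps_coef0 /= big_ord1. Qed.

HB.instance Definition _ := GRing.isZmodMorphism.Build (fps A) A fps_coef0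
  fps_coef0_zmod_morphism.
HB.instance Definition _ := GRing.isMonoidMorphism.Build (fps A) A fps_coef0
  fps_coef0_monoid_morphism.

End FpsRing.

Section FpsUnit.
Variable A : comUnitRingType.
Implicit Types f g : fps A.

Definition fps_unit : {pred fps A} := fun f => f 0%N \is a GRing.unit.

(* The first n coefficients of the inverse of f, computed from
   sum_(i <= n) f (n - i) g i = [n = 0]. *)
Fixpoint fps_inv_seq f n : seq A :=
  if n is m.+1 then
    let s := fps_inv_seq f m in
    rcons s ((f 0%N)^-1 * ((m == 0%N)%:R - \sum_(i < m) f (m - i)%N * s`_i))
  else [::].

Definition fps_inv f : fps A :=
  if f \in fps_unit then Fps (fun n => (fps_inv_seq f n.+1)`_n) else f.

Lemma size_fps_inv_seq f n : size (fps_inv_seq f n) = n.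
Proof. by elim: n => //= n IHn; rewrite size_rcons IHn. Qed.

Lemma nth_fps_inv_seq f n i :
  (i < n)%N -> (fps_inv_seq f n)`_i = (fps_inv_seq f i.+1)`_i.
Proof.
elim: n => // n IHn; rewrite ltnS leq_eqVlt => /orP[/eqP->//|lt_in].
by rewrite -IHn //= nth_rcons size_fps_inv_seq lt_in.
Qed.

Lemma fps_mulVf : {in fps_unit, left_inverse 1 fps_inv *%R}.
Proof.
move=> f Uf; rewrite /fps_inv Uf mulrC; apply: fpsP => n.
have -> : (1 : fps A) n = (n == 0%N)%:R by case: n.
rewrite [LHS](reindex_inj rev_ord_inj) big_ord_recr /=.
rewrite subSS subnn subn0 nth_rcons size_fps_inv_seq ltnn eqxx.
set S := \sum_(i < n) f (n - i)%N * (fps_inv_seq f n)`_i.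
rewrite mulrA mulrV // mul1r addrC -[RHS](subrK S).
congr (_ + _); apply: eq_bigr => i _ /=.
by rewrite subSS subKn ?(ltnW (ltn_ord i)) // (nth_fps_inv_seq f (ltn_ord i)).
Qed.

Lemma fps_unitPl f g : g * f = 1 -> fps_unit f.
Proof.
move=> /(congr1 (@fps_coef0 A)); rewrite rmorphM rmorph1 mulrC => fg1.
by apply/unitrPr; exists (fps_coef0 g).
Qed.

Lemma fps_inv_out : {in [predC fps_unit], fps_inv =1 id}.
Proof. by move=> f /negPf nUf; rewrite /fps_inv nUf. Qed.

HB.instance Definition _ := GRing.ComNzRing_hasMulInverse.Build (fps A)
  fps_mulVf fps_unitPl fps_inv_out.

Lemma fps_unitE f : (f \is a GRing.unit) = (f 0%N \is a GRing.unit).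
Proof. by []. Qed.

End FpsUnit.

Definition mx_of_rows (A : pzRingType) (n : nat) (rows : seq (seq A)) : 'M[A]_n :=
  \matrix_(i, j) (nth [::] rows i)`_j.

Definition B (K : unitRingType) (y z : K) : 'M[K]_6 := mx_of_rows 6
  [:: [:: 0;     y^-1; 0;    y; 0; 0];
      [:: y * z; 0;    y^-1; 0; y; 0];
      [:: y * z; 0;    0;    0; y; 0];
      [:: 0;     y^-1; 0;    0; 0; y^-1 * z];
      [:: 0;     y^-1; 0;    y; 0; y^-1 * z];
      [:: 0;     0;    y^-1; 0; y; 0]].

Definition B2 (A : nzRingType) (y t : A) : 'M[A]_6 := mx_of_rows 6
  [:: [:: - y; y * t;       t;     0;                y * t;       - y];
      [:: - y; y * (t - 1); 0;     y ^+ 2 * (t - 1); y * t;       - y];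
      [:: 0;   y * (t - 1); 0;     y ^+ 2 * (t - 1); 0;           - y];
      [:: - y; 0;           t - 1; 0;                y * (t - 1); 0];
      [:: - y; y * t;       t - 1; 0;                y * (t - 1); - y];
      [:: - y; y * t;       0;     y ^+ 2 * t;       y * t;       - y]].

(* Z[z](y), which contains the Laurent polynomials Z[z][y, y^-1]. *)
Notation fracyz := {fraction {poly {poly int}}}.
Definition fracy : fracyz := tofrac 'X.
Definition fracz : fracyz := tofrac 'X%:P.

Section RationalFunction.
Variable A : comNzRingType.
Implicit Types p t x y : A.

Definition num_a p t : A :=
  - 2 * p ^+ 5 * t ^+ 3 + 2 * p ^+ 4 * t ^+ 4 + 4 * p ^+ 5 * t ^+ 2
  - 8 * p ^+ 4 * t ^+ 3 - 2 * p ^+ 5 * t + 12 * p ^+ 4 * t ^+ 2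
  - 8 * p ^+ 4 * t + 6 * p ^+ 3 * t - 4 * p ^+ 2 * t ^+ 2 + 16 * p ^+ 2
  - 10 * p * t + 20 * p + 6.

Definition num_b p t : A :=
  - p ^+ 2 * t * (2 + p - t) * (p - 3 * t + 6).

Definition den_c p t : A :=
  p ^+ 6 * t ^+ 2 - 2 * p ^+ 5 * t ^+ 3 + p ^+ 4 * t ^+ 4
  + 4 * p ^+ 5 * t ^+ 2 - 4 * p ^+ 4 * t ^+ 3 - 2 * p ^+ 5 * t
  + 6 * p ^+ 4 * t ^+ 2 - 4 * p ^+ 4 * t + 2 * p ^+ 3 * t
  - p ^+ 2 * t ^+ 2 + 4 * p ^+ 2 - 2 * p * t + 4 * p + 1.

Definition den_d p t : A :=
  - p ^+ 2 * t * (2 + p - t) ^+ 2.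

Definition ratnum x y t : A := num_a (x * y) t + num_b (x * y) t * (x + x * y ^+ 2).
Definition ratden x y t : A := den_c (x * y) t + den_d (x * y) t * (x + x * y ^+ 2).

Lemma ratden0 y t : ratden 0 y t = 1.
Proof. by rewrite /ratden /den_c /den_d; ring. Qed.

End RationalFunction.

Lemma rmorph_ratden (A A' : comNzRingType) (phi : {rmorphism A -> A'}) (x y t : A) :
  phi (ratden x y t) = ratden (phi x) (phi y) (phi t).
Proof.
by rewrite /ratden /den_c /den_d !(rmorphXn, rmorphM, rmorphD, rmorphN, rmorph_nat, rmorph1).
Qed.

(* R[t][[y]][[x]]: the coefficient of x^i y^j of f is f i j. *)
Definition fpsx (R : comNzRingType) : fps (fps {poly R}) := fpsX _.
Definition fpsy (R : comNzRingType) : fps (fps {poly R}) := fpsC (fpsX _).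
Definition fpst (R : comNzRingType) : fps (fps {poly R}) := fpsC (fpsC 'X).

Definition ratfps (R : idomainType) : fps (fps {poly R}) :=
  ratnum (fpsx R) (fpsy R) (fpst R) / ratden (fpsx R) (fpsy R) (fpst R).

Lemma ratden_unit (R : idomainType) :
  ratden (fpsx R) (fpsy R) (fpst R) \is a GRing.unit.
Proof.
rewrite fps_unitE.
have -> : ratden (fpsx R) (fpsy R) (fpst R) 0%N
        = fps_coef0 (ratden (fpsx R) (fpsy R) (fpst R)) by [].
by rewrite rmorph_ratden ratden0 unitr1.
Qed.

(* Main.v *)
(* Call an edge a pair of cyclically adjacent seats. Inclusion-exclusion over
   the set S of edges occupied by couples turns T_n into a signed sum over pairs
   (w, S), where w is a pattern of n women and n men without three consecutive
   equal sexes. Only matchings S made of edges with distinct sexes contribute,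
   and such a pair is realised by n! (n - |S|)! assignments: relabel the women
   by sigma and the men by tau in one of them, with sigma = tau on the |S|
   couples sitting on S. The pairs (w, S) are the closed walks of length 2n of
   an automaton whose state records two consecutive sexes and whether their
   edge is in S; B is its weighted adjacency matrix, with y counting men minus
   women and z counting |S|. This is (i). For (ii), B2(y^2, t) is
   y^2 t B(y, -1/t)^2, and the integral turns t^k into k!. For (iii), the
   rational function is tr (1 - x B2)^-1 = sum_n x^n tr(B2^n). *)
Require Import Defs.
From HB Require Import structures.
From mathcomp Require Import all_boot all_order all_algebra.
From mathcomp Require Import all_classical all_reals all_analysis.
From mathcomp Require Import finset fingroup perm measurable_realfun zify ring.
Import Order.TTheory GRing.Theory Num.Theory.
Import numFieldNormedType.Exports.
Local Open Scope ring_scope.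
Set Implicit Arguments.
Unset Strict Implicit.
Unset Printing Implicit Defensive.

(** * Moments of the exponential distribution *)

Section ExpMoments.
Context {R : realType}.
Local Open Scope classical_set_scope.
Local Open Scope ring_scope.
Implicit Types (k : nat) (x : R).

(** Antiderivative of x^k e^(-x) produced by repeated integration by parts; it is -k! at 0 and tends
    to 0 at infinity. *)
Fixpoint moment_primitive k x : R :=
  if k is k'.+1 then k%:R * moment_primitive k' x - x ^+ k * expR (- x)
  else - expR (- x).

Lemma is_derive_expRN x : is_derive x 1 (fun y : R => expR (- y)) (- expR (- x)).
Proof.
by apply: is_derive_eq; rewrite /GRing.scale /=; ring.
Qed.

Lemma is_derive_moment_primitive k x :
  is_derive x 1 (moment_primitive k) (x ^+ k * expR (- x)).
Proof.
have dE := is_derive_expRN x; elim: k => [|k IHk] /=.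
  by apply: is_derive_eq; rewrite expr0 mul1r opprK.
have dX := is_deriveX k.+1 (is_derive_id x 1).
set P := moment_primitive k.
rewrite [X in is_derive _ _ X _](_ : _ = (k.+1%:R : R) \*: P
  - (id ^+ k.+1) * (fun y : R => expR (- y))); last first.
  by apply/funext => y; rewrite !fctE.
apply: is_derive_eq; rewrite !fctE /GRing.scale /=; ring.
Qed.

Lemma moment_primitive0 k : moment_primitive k 0 = - k`!%:R.
Proof.
elim: k => [|k IHk] /=; first by rewrite oppr0 expR0.
by rewrite IHk exprS !mul0r subr0 factS natrM mulrN.
Qed.

(** Squeezed between 0 and (k+1)!/x, because e^x exceeds x^(k+1)/(k+1)! for x > 0. *)
Lemma cvgy_expn_expRN k : x ^+ k * expR (- x) @[x --> +oo%R] --> (0 : R).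
Proof.
have h : (k.+1)`!%:R * x^-1 @[x --> +oo%R] --> (0 : R).
  rewrite -[0](mulr0 ((k.+1)`!%:R : R)); apply: cvgMr.
  apply/(gtr0_cvgV0 (f := id)); last exact: cvg_id.
  exact: nbhs_pinfty_gt.
apply: squeeze_cvgr h; [|exact: cvg_cst].
near=> x.
have x0 : 0 < x by near: x; exact: nbhs_pinfty_gt.
rewrite mulr_ge0 ?exprn_ge0 ?expR_ge0 ?ltW //=.
rewrite expRN ltr_pdivrMr ?expR_gt0 // mulrAC ltr_pdivlMr // -exprSr.
rewrite -ltr_pdivrMl ?ltr0n ?fact_gt0 // mulrC.
by apply: lt_le_trans (expR_ge1Dxn k (ltW x0)); rewrite ltrDr.
Unshelve. all: by end_near. Qed.

Lemma cvgy_moment_primitive k : moment_primitive k x @[x --> +oo%R] --> (0 : R).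
Proof.
elim: k => [|k IHk] /=.
  by rewrite -oppr0; apply: cvgN; exact: cvgr_expR.
rewrite -(subr0 0) -[X in X - _](mulr0 (k.+1%:R : R)); apply: cvgB.
  exact: cvgMr.
exact: cvgy_expn_expRN.
Qed.

Lemma continuous_moment k : continuous (fun x : R => x ^+ k * expR (- x)).
Proof.
move=> x; apply: cvgM; first exact: exprn_continuous.
apply: continuous_comp; last exact: continuous_expR.
exact: continuousN.
Qed.

(** The integrand is nonnegative and continuous, so the integral is the limit 0 of the primitive at
    infinity minus its value -k! at 0. *)
Lemma integral_moment k :
  (\int[lebesgue_measure]_(t in `[0%R, +oo[) (t ^+ k * expR (- t))%:E)%E
  = (k`!%:R : R)%:E.
Proof.
rewrite (@ge0_continuous_FTC2y R _ (moment_primitive k) 0 0).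
- by rewrite moment_primitive0 sub0e -EFinN opprK.
- by move=> x x0; rewrite mulr_ge0 ?exprn_ge0 ?expR_ge0.
- exact/continuous_subspaceT/continuous_moment.
- exact: cvgy_moment_primitive.
- by move=> x _; have := is_derive_moment_primitive k x => d; exact: ex_derive.
- have d := is_derive_moment_primitive k 0.
  apply: cvg_at_right_filter.
  by apply/differentiable_continuous/derivable1_diffP; exact: ex_derive.
- move=> x _; rewrite derive1E.
  by have d := is_derive_moment_primitive k x; exact: derive_val.
Qed.

(** The integrand is its own absolute value, so a finite integral suffices. Integrability lets the
    integral pass through finite sums. *)
Lemma integrable_moment k : lebesgue_measure.-integrable `[0%R, +oo[%classic
  (fun t : R => (t ^+ k * expR (- t))%:E).
Proof.
apply/integrableP; split.
  apply/measurable_EFinP/measurable_funTS.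
  by apply: continuous_measurable_fun; exact: continuous_moment.
under eq_integral => t.
  rewrite classical_sets.inE /= in_itv /= andbT => t0.
  rewrite ger0_norm ?mulr_ge0 ?exprn_ge0 ?expR_ge0 //; over.
by rewrite /= integral_moment ltry.
Qed.

(** Exponents may repeat and the finite index type is arbitrary, so that the sum can run over the
    pairs (w, S) directly. *)
Lemma integral_sum_monomials_expRN (I : finType) (P : pred I)
    (c : I -> R) (k : I -> nat) :
  (\int[lebesgue_measure]_(t in `[0%R, +oo[)
     ((\sum_(i | P i) c i *: 'X^(k i)).[t] * expR (- t))%:E)%E
  = (\sum_(i | P i) c i * (k i)`!%:R)%:E.
Proof.
rewrite -[in RHS]big_filter -sumEFin.
transitivity (\int[lebesgue_measure]_(t in `[0%R, +oo[)
   (\sum_(i <- [seq i <- index_enum I | P i])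
       (c i)%:E * (t ^+ k i * expR (- t))%:E))%E.
  apply: eq_integral => t _; rewrite -big_filter horner_sum mulr_suml -sumEFin.
  by apply: eq_bigr => i _; rewrite hornerZ hornerXn -mulrA EFinM.
rewrite integral_sum //=; last first.
  by move=> i; apply: integrableZl => //; exact: integrable_moment.
apply: eq_bigr => i _.
rewrite integralZl //; last exact: integrable_moment.
by rewrite integral_moment EFinM.
Qed.

End ExpMoments.

(** * The generating function of the traces of the powers of [B2] *)

Section Resolvent.
Variable A : comNzRingType.
Implicit Types x y t : A.

Definition B2_adj_rows x y t : seq (seq A) :=
  [:: [:: 1 + 3 * x * y - 2 * x * y * t + 2 * x ^+ 2 * y ^+ 2
    - x ^+ 2 * y ^+ 2 * t ^+ 2 - 2 * x ^+ 3 * y ^+ 2 * t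
    + 3 * x ^+ 3 * y ^+ 2 * t ^+ 2 - x ^+ 3 * y ^+ 2 * t ^+ 3
    + x ^+ 3 * y ^+ 3 * t - 2 * x ^+ 3 * y ^+ 4 * t
    + 3 * x ^+ 3 * y ^+ 4 * t ^+ 2 - x ^+ 3 * y ^+ 4 * t ^+ 3
    - x ^+ 4 * y ^+ 3 * t + x ^+ 4 * y ^+ 3 * t ^+ 2 - x ^+ 4 * y ^+ 4 * t
    + 3 * x ^+ 4 * y ^+ 4 * t ^+ 2 - 3 * x ^+ 4 * y ^+ 4 * t ^+ 3
    + x ^+ 4 * y ^+ 4 * t ^+ 4 - x ^+ 4 * y ^+ 5 * t + x ^+ 4 * y ^+ 5 * t ^+ 2
    + x ^+ 5 * y ^+ 5 * t ^+ 2 - x ^+ 5 * y ^+ 5 * t ^+ 3;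
      x * y * t - x ^+ 2 * y * t + x ^+ 2 * y * t ^+ 2 + x ^+ 2 * y ^+ 2 * t
        - x ^+ 3 * y ^+ 2 * t - x ^+ 3 * y ^+ 3 * t
        + 2 * x ^+ 3 * y ^+ 3 * t ^+ 2 - x ^+ 3 * y ^+ 3 * t ^+ 3
        - x ^+ 4 * y ^+ 3 * t - x ^+ 4 * y ^+ 4 * t + x ^+ 4 * y ^+ 4 * t ^+ 2;
      x * t + 2 * x ^+ 2 * y * t - x ^+ 2 * y * t ^+ 2 + 2 * x ^+ 3 * y ^+ 2 * t
        - x ^+ 3 * y ^+ 2 * t ^+ 2 + 2 * x ^+ 3 * y ^+ 3 * t
        - 3 * x ^+ 3 * y ^+ 3 * t ^+ 2 + x ^+ 3 * y ^+ 3 * t ^+ 3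
        + x ^+ 4 * y ^+ 3 * t + x ^+ 4 * y ^+ 4 * t - x ^+ 4 * y ^+ 4 * t ^+ 2;
      - (x ^+ 2 * y ^+ 2 * t) + x ^+ 2 * y ^+ 2 * t ^+ 2
        - 2 * x ^+ 2 * y ^+ 3 * t + x ^+ 2 * y ^+ 3 * t ^+ 2
        - x ^+ 3 * y ^+ 3 * t - 3 * x ^+ 3 * y ^+ 4 * t
        + x ^+ 3 * y ^+ 4 * t ^+ 2 - x ^+ 4 * y ^+ 4 * t
        + 2 * x ^+ 4 * y ^+ 4 * t ^+ 2 - x ^+ 4 * y ^+ 4 * t ^+ 3
        - x ^+ 4 * y ^+ 5 * t + x ^+ 5 * y ^+ 5 * t ^+ 2;
      x * y * t + x ^+ 2 * y ^+ 2 * t - 2 * x ^+ 3 * y ^+ 2 * t ^+ 2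
        + x ^+ 3 * y ^+ 2 * t ^+ 3 + 2 * x ^+ 3 * y ^+ 4 * t
        - 3 * x ^+ 3 * y ^+ 4 * t ^+ 2 + x ^+ 3 * y ^+ 4 * t ^+ 3
        - x ^+ 4 * y ^+ 3 * t ^+ 2 + x ^+ 4 * y ^+ 4 * t
        - 3 * x ^+ 4 * y ^+ 4 * t ^+ 2 + 3 * x ^+ 4 * y ^+ 4 * t ^+ 3
        - x ^+ 4 * y ^+ 4 * t ^+ 4 + x ^+ 4 * y ^+ 5 * t
        - x ^+ 4 * y ^+ 5 * t ^+ 2 - x ^+ 5 * y ^+ 5 * t ^+ 2
        + x ^+ 5 * y ^+ 5 * t ^+ 3;
      - (x * y) - x ^+ 2 * y * t - 2 * x ^+ 2 * y ^+ 2 - 2 * x ^+ 3 * y ^+ 3 * t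
        + x ^+ 3 * y ^+ 3 * t ^+ 2 + x ^+ 4 * y ^+ 3 * t];
      [:: - (x * y) - x ^+ 2 * y ^+ 2 + x ^+ 2 * y ^+ 3 - x ^+ 2 * y ^+ 3 * t
        + x ^+ 3 * y ^+ 3 - 2 * x ^+ 3 * y ^+ 3 * t + x ^+ 3 * y ^+ 3 * t ^+ 2
        + x ^+ 3 * y ^+ 4 + x ^+ 4 * y ^+ 4 - x ^+ 4 * y ^+ 4 * t
        + x ^+ 4 * y ^+ 5;
      1 + 3 * x * y - x * y * t + x ^+ 2 * y ^+ 2 + 2 * x ^+ 2 * y ^+ 2 * t
        - x ^+ 2 * y ^+ 2 * t ^+ 2 - 2 * x ^+ 3 * y ^+ 2 * t
        + x ^+ 3 * y ^+ 2 * t ^+ 2 - 2 * x ^+ 3 * y ^+ 3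
        + 2 * x ^+ 3 * y ^+ 3 * t - 2 * x ^+ 3 * y ^+ 4 * t
        + x ^+ 3 * y ^+ 4 * t ^+ 2 - x ^+ 4 * y ^+ 3 * t
        - 3 * x ^+ 4 * y ^+ 4 * t + 3 * x ^+ 4 * y ^+ 4 * t ^+ 2
        - x ^+ 4 * y ^+ 4 * t ^+ 3 - x ^+ 4 * y ^+ 5 * t - x ^+ 5 * y ^+ 5 * t
        + x ^+ 5 * y ^+ 5 * t ^+ 2;
      - (2 * x ^+ 2 * y * t) + x ^+ 2 * y * t ^+ 2 + x ^+ 2 * y ^+ 2
        - 2 * x ^+ 2 * y ^+ 2 * t + x ^+ 2 * y ^+ 2 * t ^+ 2
        - x ^+ 3 * y ^+ 2 * t + 2 * x ^+ 3 * y ^+ 3 - 2 * x ^+ 3 * y ^+ 3 * t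
        + 2 * x ^+ 4 * y ^+ 4 * t - x ^+ 4 * y ^+ 4 * t ^+ 2
        + x ^+ 5 * y ^+ 5 * t;
      - (x * y ^+ 2) + x * y ^+ 2 * t - 3 * x ^+ 2 * y ^+ 3
        + 3 * x ^+ 2 * y ^+ 3 * t - x ^+ 2 * y ^+ 3 * t ^+ 2
        + 2 * x ^+ 3 * y ^+ 3 * t - 3 * x ^+ 3 * y ^+ 3 * t ^+ 2
        + x ^+ 3 * y ^+ 3 * t ^+ 3 - 2 * x ^+ 3 * y ^+ 4 + x ^+ 3 * y ^+ 4 * t
        + 3 * x ^+ 4 * y ^+ 4 * t - 2 * x ^+ 4 * y ^+ 4 * t ^+ 2
        + x ^+ 5 * y ^+ 5 * t;
      x * y * t + x ^+ 2 * y ^+ 3 - 2 * x ^+ 2 * y ^+ 3 * t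
        + x ^+ 2 * y ^+ 3 * t ^+ 2 - x ^+ 3 * y ^+ 3 * t
        + 2 * x ^+ 3 * y ^+ 3 * t ^+ 2 - x ^+ 3 * y ^+ 3 * t ^+ 3
        + 2 * x ^+ 3 * y ^+ 4 - 2 * x ^+ 3 * y ^+ 4 * t
        - 2 * x ^+ 4 * y ^+ 4 * t + 2 * x ^+ 4 * y ^+ 4 * t ^+ 2
        - x ^+ 5 * y ^+ 5 * t;
      - (x * y) - x ^+ 2 * y ^+ 2 + 2 * x ^+ 3 * y ^+ 2 * t
        - x ^+ 3 * y ^+ 2 * t ^+ 2 - 2 * x ^+ 3 * y ^+ 4
        + 3 * x ^+ 3 * y ^+ 4 * t - x ^+ 3 * y ^+ 4 * t ^+ 2
        + x ^+ 4 * y ^+ 3 * t - x ^+ 4 * y ^+ 4 + 3 * x ^+ 4 * y ^+ 4 * t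
        - 3 * x ^+ 4 * y ^+ 4 * t ^+ 2 + x ^+ 4 * y ^+ 4 * t ^+ 3
        - x ^+ 4 * y ^+ 5 + x ^+ 4 * y ^+ 5 * t + x ^+ 5 * y ^+ 5 * t
        - x ^+ 5 * y ^+ 5 * t ^+ 2];
      [:: 2 * x ^+ 2 * y ^+ 2 - x ^+ 2 * y ^+ 2 * t + x ^+ 2 * y ^+ 3
        - x ^+ 2 * y ^+ 3 * t + 3 * x ^+ 3 * y ^+ 3 - x ^+ 3 * y ^+ 3 * t
        + x ^+ 3 * y ^+ 4 + x ^+ 4 * y ^+ 4 + x ^+ 4 * y ^+ 5
        - 2 * x ^+ 4 * y ^+ 5 * t + x ^+ 4 * y ^+ 5 * t ^+ 2
        - x ^+ 5 * y ^+ 6 * t;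
      - (x * y) + x * y * t - 3 * x ^+ 2 * y ^+ 2 + 3 * x ^+ 2 * y ^+ 2 * t
        - x ^+ 2 * y ^+ 2 * t ^+ 2 - 2 * x ^+ 3 * y ^+ 3 + x ^+ 3 * y ^+ 3 * t
        + 2 * x ^+ 3 * y ^+ 4 * t - 3 * x ^+ 3 * y ^+ 4 * t ^+ 2
        + x ^+ 3 * y ^+ 4 * t ^+ 3 + 3 * x ^+ 4 * y ^+ 5 * t
        - 2 * x ^+ 4 * y ^+ 5 * t ^+ 2 + x ^+ 5 * y ^+ 6 * t;
      1 + 4 * x * y - 2 * x * y * t + 5 * x ^+ 2 * y ^+ 2
        - 2 * x ^+ 2 * y ^+ 2 * t + 2 * x ^+ 3 * y ^+ 3
        - 4 * x ^+ 3 * y ^+ 4 * t + 4 * x ^+ 3 * y ^+ 4 * t ^+ 2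
        - x ^+ 3 * y ^+ 4 * t ^+ 3 - 4 * x ^+ 4 * y ^+ 5 * t
        + 2 * x ^+ 4 * y ^+ 5 * t ^+ 2 - x ^+ 5 * y ^+ 6 * t;
      - (x * y ^+ 2) + x * y ^+ 2 * t - 3 * x ^+ 2 * y ^+ 3
        + 3 * x ^+ 2 * y ^+ 3 * t - x ^+ 2 * y ^+ 3 * t ^+ 2
        - 2 * x ^+ 3 * y ^+ 4 - x ^+ 3 * y ^+ 4 * t
        + 3 * x ^+ 3 * y ^+ 4 * t ^+ 2 - x ^+ 3 * y ^+ 4 * t ^+ 3
        - 3 * x ^+ 4 * y ^+ 5 * t + 2 * x ^+ 4 * y ^+ 5 * t ^+ 2
        - x ^+ 5 * y ^+ 6 * t;
      - (2 * x ^+ 2 * y ^+ 2 * t) + x ^+ 2 * y ^+ 2 * t ^+ 2 + x ^+ 2 * y ^+ 3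
        - 2 * x ^+ 2 * y ^+ 3 * t + x ^+ 2 * y ^+ 3 * t ^+ 2
        - x ^+ 3 * y ^+ 3 * t + 2 * x ^+ 3 * y ^+ 4 - 2 * x ^+ 3 * y ^+ 4 * t
        + 2 * x ^+ 4 * y ^+ 5 * t - x ^+ 4 * y ^+ 5 * t ^+ 2
        + x ^+ 5 * y ^+ 6 * t;
      - (x * y) - 2 * x ^+ 2 * y ^+ 2 + x ^+ 2 * y ^+ 2 * t
        - 2 * x ^+ 3 * y ^+ 3 + x ^+ 3 * y ^+ 3 * t - 2 * x ^+ 3 * y ^+ 4
        + 3 * x ^+ 3 * y ^+ 4 * t - x ^+ 3 * y ^+ 4 * t ^+ 2 - x ^+ 4 * y ^+ 4
        - x ^+ 4 * y ^+ 5 + x ^+ 4 * y ^+ 5 * t];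
      [:: - (x * y) - 2 * x ^+ 2 * y ^+ 2 + x ^+ 2 * y ^+ 2 * t
        - 2 * x ^+ 3 * y ^+ 2 + 3 * x ^+ 3 * y ^+ 2 * t
        - x ^+ 3 * y ^+ 2 * t ^+ 2 - 2 * x ^+ 3 * y ^+ 3 + x ^+ 3 * y ^+ 3 * t
        - x ^+ 4 * y ^+ 3 + x ^+ 4 * y ^+ 3 * t - x ^+ 4 * y ^+ 4;
      x ^+ 2 * y - 2 * x ^+ 2 * y * t + x ^+ 2 * y * t ^+ 2
        - 2 * x ^+ 2 * y ^+ 2 * t + x ^+ 2 * y ^+ 2 * t ^+ 2
        + 2 * x ^+ 3 * y ^+ 2 - 2 * x ^+ 3 * y ^+ 2 * t - x ^+ 3 * y ^+ 3 * t
        + 2 * x ^+ 4 * y ^+ 3 * t - x ^+ 4 * y ^+ 3 * t ^+ 2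
        + x ^+ 5 * y ^+ 4 * t;
      - (x) + x * t - 3 * x ^+ 2 * y + 3 * x ^+ 2 * y * t - x ^+ 2 * y * t ^+ 2
        - 2 * x ^+ 3 * y ^+ 2 - x ^+ 3 * y ^+ 2 * t
        + 3 * x ^+ 3 * y ^+ 2 * t ^+ 2 - x ^+ 3 * y ^+ 2 * t ^+ 3
        - 3 * x ^+ 4 * y ^+ 3 * t + 2 * x ^+ 4 * y ^+ 3 * t ^+ 2
        - x ^+ 5 * y ^+ 4 * t;
      1 + 4 * x * y - 2 * x * y * t + 5 * x ^+ 2 * y ^+ 2
        - 2 * x ^+ 2 * y ^+ 2 * t - 4 * x ^+ 3 * y ^+ 2 * t
        + 4 * x ^+ 3 * y ^+ 2 * t ^+ 2 - x ^+ 3 * y ^+ 2 * t ^+ 3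
        + 2 * x ^+ 3 * y ^+ 3 - 4 * x ^+ 4 * y ^+ 3 * t
        + 2 * x ^+ 4 * y ^+ 3 * t ^+ 2 - x ^+ 5 * y ^+ 4 * t;
      - (x * y) + x * y * t - 3 * x ^+ 2 * y ^+ 2 + 3 * x ^+ 2 * y ^+ 2 * t
        - x ^+ 2 * y ^+ 2 * t ^+ 2 + 2 * x ^+ 3 * y ^+ 2 * t
        - 3 * x ^+ 3 * y ^+ 2 * t ^+ 2 + x ^+ 3 * y ^+ 2 * t ^+ 3
        - 2 * x ^+ 3 * y ^+ 3 + x ^+ 3 * y ^+ 3 * t + 3 * x ^+ 4 * y ^+ 3 * t
        - 2 * x ^+ 4 * y ^+ 3 * t ^+ 2 + x ^+ 5 * y ^+ 4 * t;
      x ^+ 2 * y - x ^+ 2 * y * t + 2 * x ^+ 2 * y ^+ 2 - x ^+ 2 * y ^+ 2 * t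
        + x ^+ 3 * y ^+ 2 + 3 * x ^+ 3 * y ^+ 3 - x ^+ 3 * y ^+ 3 * t
        + x ^+ 4 * y ^+ 3 - 2 * x ^+ 4 * y ^+ 3 * t + x ^+ 4 * y ^+ 3 * t ^+ 2
        + x ^+ 4 * y ^+ 4 - x ^+ 5 * y ^+ 4 * t];
      [:: - (x * y) - x ^+ 2 * y ^+ 2 - 2 * x ^+ 3 * y ^+ 2
        + 3 * x ^+ 3 * y ^+ 2 * t - x ^+ 3 * y ^+ 2 * t ^+ 2
        + 2 * x ^+ 3 * y ^+ 4 * t - x ^+ 3 * y ^+ 4 * t ^+ 2 - x ^+ 4 * y ^+ 3
        + x ^+ 4 * y ^+ 3 * t - x ^+ 4 * y ^+ 4 + 3 * x ^+ 4 * y ^+ 4 * t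
        - 3 * x ^+ 4 * y ^+ 4 * t ^+ 2 + x ^+ 4 * y ^+ 4 * t ^+ 3
        + x ^+ 4 * y ^+ 5 * t + x ^+ 5 * y ^+ 5 * t - x ^+ 5 * y ^+ 5 * t ^+ 2;
      x * y * t + x ^+ 2 * y - 2 * x ^+ 2 * y * t + x ^+ 2 * y * t ^+ 2
        + 2 * x ^+ 3 * y ^+ 2 - 2 * x ^+ 3 * y ^+ 2 * t - x ^+ 3 * y ^+ 3 * t
        + 2 * x ^+ 3 * y ^+ 3 * t ^+ 2 - x ^+ 3 * y ^+ 3 * t ^+ 3
        - 2 * x ^+ 4 * y ^+ 4 * t + 2 * x ^+ 4 * y ^+ 4 * t ^+ 2
        - x ^+ 5 * y ^+ 5 * t;
      - (x) + x * t - 3 * x ^+ 2 * y + 3 * x ^+ 2 * y * t - x ^+ 2 * y * t ^+ 2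
        - 2 * x ^+ 3 * y ^+ 2 + x ^+ 3 * y ^+ 2 * t + 2 * x ^+ 3 * y ^+ 3 * t
        - 3 * x ^+ 3 * y ^+ 3 * t ^+ 2 + x ^+ 3 * y ^+ 3 * t ^+ 3
        + 3 * x ^+ 4 * y ^+ 4 * t - 2 * x ^+ 4 * y ^+ 4 * t ^+ 2
        + x ^+ 5 * y ^+ 5 * t;
      x ^+ 2 * y ^+ 2 - 2 * x ^+ 2 * y ^+ 2 * t + x ^+ 2 * y ^+ 2 * t ^+ 2
        - 2 * x ^+ 2 * y ^+ 3 * t + x ^+ 2 * y ^+ 3 * t ^+ 2
        + 2 * x ^+ 3 * y ^+ 3 - 2 * x ^+ 3 * y ^+ 3 * t - x ^+ 3 * y ^+ 4 * t
        + 2 * x ^+ 4 * y ^+ 4 * t - x ^+ 4 * y ^+ 4 * t ^+ 2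
        + x ^+ 5 * y ^+ 5 * t;
      1 + 3 * x * y - x * y * t + x ^+ 2 * y ^+ 2 + 2 * x ^+ 2 * y ^+ 2 * t
        - x ^+ 2 * y ^+ 2 * t ^+ 2 - 2 * x ^+ 3 * y ^+ 2 * t
        + x ^+ 3 * y ^+ 2 * t ^+ 2 - 2 * x ^+ 3 * y ^+ 3
        + 2 * x ^+ 3 * y ^+ 3 * t - 2 * x ^+ 3 * y ^+ 4 * t
        + x ^+ 3 * y ^+ 4 * t ^+ 2 - x ^+ 4 * y ^+ 3 * t
        - 3 * x ^+ 4 * y ^+ 4 * t + 3 * x ^+ 4 * y ^+ 4 * t ^+ 2
        - x ^+ 4 * y ^+ 4 * t ^+ 3 - x ^+ 4 * y ^+ 5 * t - x ^+ 5 * y ^+ 5 * t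
        + x ^+ 5 * y ^+ 5 * t ^+ 2;
      - (x * y) + x ^+ 2 * y - x ^+ 2 * y * t - x ^+ 2 * y ^+ 2
        + x ^+ 3 * y ^+ 2 + x ^+ 3 * y ^+ 3 - 2 * x ^+ 3 * y ^+ 3 * t
        + x ^+ 3 * y ^+ 3 * t ^+ 2 + x ^+ 4 * y ^+ 3 + x ^+ 4 * y ^+ 4
        - x ^+ 4 * y ^+ 4 * t];
      [:: - (x * y) - 2 * x ^+ 2 * y ^+ 2 - x ^+ 2 * y ^+ 3 * t
        - 2 * x ^+ 3 * y ^+ 3 * t + x ^+ 3 * y ^+ 3 * t ^+ 2
        + x ^+ 4 * y ^+ 5 * t;
      x * y * t + x ^+ 2 * y ^+ 2 * t + 2 * x ^+ 3 * y ^+ 2 * t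
        - 3 * x ^+ 3 * y ^+ 2 * t ^+ 2 + x ^+ 3 * y ^+ 2 * t ^+ 3
        - 2 * x ^+ 3 * y ^+ 4 * t ^+ 2 + x ^+ 3 * y ^+ 4 * t ^+ 3
        + x ^+ 4 * y ^+ 3 * t - x ^+ 4 * y ^+ 3 * t ^+ 2 + x ^+ 4 * y ^+ 4 * t
        - 3 * x ^+ 4 * y ^+ 4 * t ^+ 2 + 3 * x ^+ 4 * y ^+ 4 * t ^+ 3
        - x ^+ 4 * y ^+ 4 * t ^+ 4 - x ^+ 4 * y ^+ 5 * t ^+ 2
        - x ^+ 5 * y ^+ 5 * t ^+ 2 + x ^+ 5 * y ^+ 5 * t ^+ 3;
      - (2 * x ^+ 2 * y * t) + x ^+ 2 * y * t ^+ 2 - x ^+ 2 * y ^+ 2 * t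
        + x ^+ 2 * y ^+ 2 * t ^+ 2 - 3 * x ^+ 3 * y ^+ 2 * t
        + x ^+ 3 * y ^+ 2 * t ^+ 2 - x ^+ 3 * y ^+ 3 * t - x ^+ 4 * y ^+ 3 * t
        - x ^+ 4 * y ^+ 4 * t + 2 * x ^+ 4 * y ^+ 4 * t ^+ 2
        - x ^+ 4 * y ^+ 4 * t ^+ 3 + x ^+ 5 * y ^+ 5 * t ^+ 2;
      x * y ^+ 2 * t + 2 * x ^+ 2 * y ^+ 3 * t - x ^+ 2 * y ^+ 3 * t ^+ 2
        + 2 * x ^+ 3 * y ^+ 3 * t - 3 * x ^+ 3 * y ^+ 3 * t ^+ 2
        + x ^+ 3 * y ^+ 3 * t ^+ 3 + 2 * x ^+ 3 * y ^+ 4 * t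
        - x ^+ 3 * y ^+ 4 * t ^+ 2 + x ^+ 4 * y ^+ 4 * t
        - x ^+ 4 * y ^+ 4 * t ^+ 2 + x ^+ 4 * y ^+ 5 * t;
      x * y * t + x ^+ 2 * y ^+ 2 * t - x ^+ 2 * y ^+ 3 * t
        + x ^+ 2 * y ^+ 3 * t ^+ 2 - x ^+ 3 * y ^+ 3 * t
        + 2 * x ^+ 3 * y ^+ 3 * t ^+ 2 - x ^+ 3 * y ^+ 3 * t ^+ 3
        - x ^+ 3 * y ^+ 4 * t - x ^+ 4 * y ^+ 4 * t + x ^+ 4 * y ^+ 4 * t ^+ 2
        - x ^+ 4 * y ^+ 5 * t;
      1 + 3 * x * y - 2 * x * y * t + 2 * x ^+ 2 * y ^+ 2
        - x ^+ 2 * y ^+ 2 * t ^+ 2 - 2 * x ^+ 3 * y ^+ 2 * t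
        + 3 * x ^+ 3 * y ^+ 2 * t ^+ 2 - x ^+ 3 * y ^+ 2 * t ^+ 3
        + x ^+ 3 * y ^+ 3 * t - 2 * x ^+ 3 * y ^+ 4 * t
        + 3 * x ^+ 3 * y ^+ 4 * t ^+ 2 - x ^+ 3 * y ^+ 4 * t ^+ 3
        - x ^+ 4 * y ^+ 3 * t + x ^+ 4 * y ^+ 3 * t ^+ 2 - x ^+ 4 * y ^+ 4 * t
        + 3 * x ^+ 4 * y ^+ 4 * t ^+ 2 - 3 * x ^+ 4 * y ^+ 4 * t ^+ 3
        + x ^+ 4 * y ^+ 4 * t ^+ 4 - x ^+ 4 * y ^+ 5 * t
        + x ^+ 4 * y ^+ 5 * t ^+ 2 + x ^+ 5 * y ^+ 5 * t ^+ 2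
        - x ^+ 5 * y ^+ 5 * t ^+ 3]].

(* The adjugate of [1 - x *: B2 y t]; its determinant is [ratden x y t]. *)
Definition B2_adj x y t : 'M[A]_6 := mx_of_rows 6 (B2_adj_rows x y t).

(** One polynomial identity for each of the 36 entries. This product and the trace of [B2_adj]
    suffice for the resolvent, so no determinant is computed. *)
Lemma mul_B2_adj x y t :
  (1 - x *: B2 y t) *m B2_adj x y t = (ratden x y t)%:M.
Proof.
(* [M] is abstract, so that only the entries occurring in a sum are unfolded. *)
have [M ME] : exists M, M = B2_adj x y t by eexists.
have entry i j : M i j = (nth [::] (B2_adj_rows x y t) i)`_j by rewrite ME mxE.
rewrite -ME; apply/matrixP => i j.
rewrite mxE !big_ord_recl big_ord0 !mxE !entry {M ME entry}.
case: i => [[|[|[|[|[|[|//]]]]]] Hi];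
 case: j => [[|[|[|[|[|[|//]]]]]] Hj];
 rewrite /= /ratden /den_c /den_d.
all: ring.
Qed.

Lemma mxtrace_B2_adj x y t : \tr (B2_adj x y t) = ratnum x y t.
Proof.
rewrite /mxtrace !big_ord_recl big_ord0 !mxE /= /ratnum /num_a /num_b.
ring.
Qed.

End Resolvent.

(** * Embeddings into power series and the geometric series of a matrix *)

Section FpsMorphisms.
Variable A : comNzRingType.

Lemma fpsC_zmod_morphism : zmod_morphism (@fpsC A).
Proof. by move=> a b; apply: fpsP => -[|n] //=; rewrite subrr. Qed.
Lemma fpsC_monoid_morphism : monoid_morphism (@fpsC A).
Proof.
split=> // a b; apply: fpsP => n /=; rewrite big_ord_recl /= subn0 big1 ?addr0.
  by case: n => //= n; rewrite mulr0.
by move=> i _; rewrite mul0r.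
Qed.

HB.instance Definition _ :=
  GRing.isZmodMorphism.Build A (fps A) (@fpsC A) fpsC_zmod_morphism.
HB.instance Definition _ :=
  GRing.isMonoidMorphism.Build A (fps A) (@fpsC A) fpsC_monoid_morphism.

Definition fps_of_poly (p : {poly A}) : fps A := Fps (fun n => p`_n).

Lemma fps_of_poly_zmod_morphism : zmod_morphism fps_of_poly.
Proof. by move=> p q; apply: fpsP => n /=; rewrite coefB. Qed.
Lemma fps_of_poly_monoid_morphism : monoid_morphism fps_of_poly.
Proof.
split=> [|p q]; apply: fpsP => n /=; first by rewrite coefC; case: n.
by rewrite coefM.
Qed.

HB.instance Definition _ :=
  GRing.isZmodMorphism.Build {poly A} (fps A) fps_of_poly
    fps_of_poly_zmod_morphism.
HB.instance Definition _ :=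
  GRing.isMonoidMorphism.Build {poly A} (fps A) fps_of_poly
    fps_of_poly_monoid_morphism.

Lemma fps_of_polyX : fps_of_poly 'X = fpsX A.
Proof. by apply: fpsP => n /=; rewrite coefX. Qed.

Lemma fps_of_polyC a : fps_of_poly a%:P = fpsC a.
Proof. by apply: fpsP => -[|n] /=; rewrite coefC. Qed.

Lemma fpsCM_coef a (f : fps A) n : (fpsC a * f) n = a * f n.
Proof.
rewrite /= big_ord_recl /= subn0 big1 ?addr0 // => i _.
by rewrite mul0r.
Qed.

Lemma fpsXM_coef (f : fps A) n :
  (fpsX A * f) n = if n is n'.+1 then f n' else 0.
Proof.
rewrite /= big_ord_recl /= mul0r add0r; case: n => [|n]; first by rewrite big_ord0.
rewrite big_ord_recl /= mul1r subSS subn0 big1 ?addr0 // => i _.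
by rewrite mul0r.
Qed.

Lemma fps_sum_coef (I : Type) (r : seq I) (F : I -> fps A) n :
  (\sum_(i <- r) F i) n = \sum_(i <- r) F i n.
Proof.
by apply: (big_morph (fun f : fps A => f n)) => //; case: n.
Qed.

Variable k : nat.

(** The sum of all x^n M^n, stored as a matrix of series because [fps] is a ring only over
    commutative coefficients. *)
Definition mx_geom (M : 'M[A]_k.+1) : 'M[fps A]_k.+1 :=
  \matrix_(i, j) Fps (fun n => (M ^+ n) i j).

(** Telescoping: in degree n > 0 the term M^n cancels against M times M^(n-1), and the identity
    remains in degree 0. *)
Lemma mul_mx_geom (M : 'M[A]_k.+1) :
  (1 - fpsX A *: map_mx (@fpsC A) M) *m mx_geom M = 1.
Proof.
rewrite mulmxBl mul1mx -scalemxAl; apply/matrixP => i j.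
rewrite !mxE; apply: fpsP => n.
transitivity ((M ^+ n) i j
  - (fpsX A * (\sum_l map_mx (@fpsC A) M i l * mx_geom M l j)) n) => //.
rewrite fpsXM_coef; case: n => [|n].
  by rewrite subr0 expr0 mxE; case: eqP.
rewrite fps_sum_coef exprS mxE.
rewrite -sumrB big1 => [|l _]; first by case: eqP.
by rewrite !mxE fpsCM_coef /= subrr.
Qed.

End FpsMorphisms.

(** The entries are integer polynomials in [y] and [t], so traces can be carried between
    polynomials, series and fractions. *)
Lemma map_B2 (A A' : nzRingType) (phi : {rmorphism A -> A'}) (y t : A) :
  map_mx phi (B2 y t) = B2 (phi y) (phi t).
Proof.
apply/matrixP => i j; rewrite !mxE.
case: i => [[|[|[|[|[|[|//]]]]]] Hi];
 case: j => [[|[|[|[|[|[|//]]]]]] Hj];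
 by rewrite /= ?(rmorphXn, rmorphM, rmorphB, rmorphN, rmorph1, rmorph0).
Qed.

Lemma rmorph_mxtrace_B2_expr (A A' : comNzRingType) (phi : {rmorphism A -> A'})
  (y t : A) n : phi (\tr (B2 y t ^+ n)) = \tr (B2 (phi y) (phi t) ^+ n).
Proof.
rewrite -trace_map_mx; congr (\tr _).
transitivity (map_mx phi (B2 y t) ^+ n); first exact: rmorphXn.
by rewrite map_B2.
Qed.

(** [ratfps] is the trace of the geometric series of [M], whose coefficient of x^n is tr(M^n). *)
Lemma ratfps_coef (R : idomainType) (n k : nat) :
  ratfps R n k = (\tr (B2 'X ('X%:P : {poly {poly R}}) ^+ n))`_k.
Proof.
pose M : 'M[fps {poly R}]_6 := B2 (fpsX _) (fpsC 'X).
have MC : B2 (fpsy R) (fpst R) = map_mx (@fpsC _) M by rewrite map_B2.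
have trG : ratfps R = \tr (mx_geom M).
  rewrite /ratfps -mxtrace_B2_adj; apply: (mulIr (ratden_unit R)).
  (* A right inverse of a square matrix is also a left inverse, so multiplying [mul_B2_adj] by
     [mx_geom M] on the left gives the adjugate as [ratden] times [mx_geom M]. *)
  rewrite divrK ?ratden_unit // mulrC -mxtraceZ -mul_mx_scalar -mul_B2_adj MC.
  by rewrite mulmxA (mulmx1C (mul_mx_geom M)) mul1mx.
have -> : (\tr (B2 'X ('X%:P : {poly {poly R}}) ^+ n))`_k = (\tr (M ^+ n)) k.
  rewrite -[LHS]/(fps_of_poly _ k) rmorph_mxtrace_B2_expr.
  by rewrite /= fps_of_polyX fps_of_polyC.
rewrite trG /mxtrace !fps_sum_coef.
by apply: eq_bigr => i _; rewrite mxE.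
Qed.

(** * Powers of a matrix and closed walks *)

Section Walks.
Variables (T : finType).

Definition ffun_cons n (a : T) (g : {ffun 'I_n -> T}) : {ffun 'I_n.+1 -> T} :=
  [ffun i => oapp g a (unlift ord0 i)].

Lemma big_ffun_cons (R : Type) (idx : R) (op : Monoid.com_law idx) n
    (F : {ffun 'I_n.+1 -> T} -> R) :
  \big[op/idx]_f F f = \big[op/idx]_a \big[op/idx]_g F (ffun_cons a g).
Proof.
rewrite pair_big /= (reindex (fun p => ffun_cons p.1 p.2)) //=.
exists (fun f => (f ord0, [ffun j => f (lift ord0 j)])) => [[a g] _|f _] /=.
  congr (_, _); first by rewrite ffunE unlift_none.
  by apply/ffunP => j; rewrite !ffunE liftK.
by apply/ffunP => i; rewrite !ffunE; case: unliftP => [j|] -> //=; rewrite ffunE.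
Qed.

End Walks.

Section TracePower.
Variables (A : comNzRingType) (k : nat).
Implicit Types (M : 'M[A]_k.+1) (N : nat).

(** [f] lists the N interior vertices of a walk of N+1 steps. Step i starts at [a] if i = 0 and else
    at vertex i-1 of [f]; it ends at [b] if i = N and else at vertex i. *)
Lemma exprmx_walk M N a b :
  (M ^+ N.+1) a b = \sum_(f : {ffun 'I_N -> 'I_k.+1})
    \prod_i M (oapp f a (unlift ord0 i)) (oapp f b (unlift ord_max i)).
Proof.
elim: N a => [|N IHN] a.
  have all1 (f : {ffun 'I_0 -> 'I_k.+1}) : f = [ffun=> a].
    by apply/ffunP => -[].
  rewrite expr1 (bigD1 [ffun=> a]) //= [X in _ + X]big1 ?addr0; last first.
    by move=> f; rewrite (all1 f) eqxx.
  rewrite big_ord1 unlift_none.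
  have -> : (ord0 : 'I_1) = ord_max by apply: val_inj.
  by rewrite unlift_none.
rewrite exprS mxE big_ffun_cons; apply: eq_bigr => c _.
rewrite IHN mulr_sumr; apply: eq_bigr => f _.
rewrite [RHS]big_ord_recl unlift_none /=.
have -> : unlift ord_max (ord0 : 'I_N.+2) = Some ord0.
  have -> : ord0 = lift ord_max (ord0 : 'I_N.+1) by exact: val_inj.
  by rewrite liftK.
rewrite /= !ffunE unlift_none /=; congr (_ * _); apply: eq_bigr => i _.
rewrite liftK /= ffunE; congr (M _ _).
have [j|] := unliftP ord_max i => ->.
  have -> : lift ord0 (lift ord_max j) = lift ord_max (lift ord0 j) :> 'I_N.+2.
    have jN : (N <= j)%N = false by rewrite leqNgt ltn_ord.
    by apply: val_inj; rewrite /= /bump !add1n /= ltnS jN.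
  by rewrite liftK /= ffunE liftK.
have -> : lift ord0 ord_max = ord_max :> 'I_N.+2 by apply: val_inj.
by rewrite unlift_none.
Qed.

(** On the diagonal both ends of the walk coincide and become the vertex at [ord0]; the last step
    returns there, as [ordS] does. For N = 0 the sides would be k+1 and 1. *)
Lemma mxtrace_expr_walk M N : (0 < N)%N ->
  \tr (M ^+ N) = \sum_(f : {ffun 'I_N -> 'I_k.+1}) \prod_i M (f i) (f (ordS i)).
Proof.
case: N => // N _; rewrite big_ffun_cons; apply: eq_bigr => a _.
rewrite exprmx_walk; apply: eq_bigr => f _; apply: eq_bigr => i _.
rewrite !ffunE; congr (M _ (oapp f a _)).
have [j|] := unliftP ord_max i => ->.
  have -> : ordS (lift ord_max j) = lift ord0 j.
    by apply: val_inj; rewrite /= /bump leqNgt ltn_ord add0n add1n modn_small ?ltnS.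
  by rewrite liftK.
have -> : ordS (ord_max : 'I_N.+1) = ord0.
  by apply: val_inj; rewrite /= modnn.
by rewrite unlift_none.
Qed.

End TracePower.

(** * Sex patterns and sets of edges *)

Section Patterns.
Variable N : nat.
Implicit Types (w : {ffun 'I_N -> bool}) (S : {set 'I_N}).

Definition no_three w : bool :=
  [forall i, ~~ ((w i == w (ordS i)) && (w (ordS i) == w (ordS (ordS i))))].

(* [i \in S] stands for the edge between the seats [i] and [ordS i]. *)
Definition edge_matching w S : bool :=
  [forall i, ((i \in S) ==> (w i != w (ordS i))) &&
             ~~ ((i \in S) && (ordS i \in S))].

End Patterns.

(** * The transfer matrix *)

(* The states of the transfer matrix [B]: sex of a seat, sex of the next seat,
   and whether these two seats are matched. *)
Definition st_sex (s : 'I_6) : bool :=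
  nth false [:: false; true; false; true; false; true] s.
Definition st_next (s : 'I_6) : bool :=
  nth false [:: true; false; false; true; true; false] s.
Definition st_edge (s : 'I_6) : bool :=
  nth false [:: true; false; false; false; false; true] s.
(** Eight triples share six states, numbered as the rows of [B]: a matched edge joins distinct
    sexes, so [g] is ignored when [a = b]. *)
Definition state_of (a b g : bool) : 'I_6 :=
  inord (if a then if b then 3%N else if g then 5%N else 1%N
         else if b then if g then 0%N else 4%N else 2%N).

Lemma state_ofK a b g : (g ==> (a != b)) ->
  [/\ st_sex (state_of a b g) = a, st_next (state_of a b g) = b
    & st_edge (state_of a b g) = g].
Proof.
by rewrite /st_sex /st_next /st_edge /state_of; case: a b g => [] [] [] // _;
  rewrite inordK.
Qed.

Lemma state_of_st s : state_of (st_sex s) (st_next s) (st_edge s) = s.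
Proof.
by apply: val_inj; case: s => [[|[|[|[|[|[|//]]]]]] Hs];
  rewrite /state_of /= inordK.
Qed.

Lemma st_edgeW s : st_edge s ==> (st_sex s != st_next s).
Proof. by case: s => [[|[|[|[|[|[|//]]]]]] Hs]. Qed.

Definition st_trans (s s' : 'I_6) : bool :=
  [&& st_next s == st_sex s',
      ~~ ((st_sex s == st_next s) && (st_next s == st_next s'))
    & ~~ (st_edge s && st_edge s')].

Section Transfer.
Variable K : fieldType.
Variables y z : K.

(** The weight depends only on the target state, so a closed walk weighs each seat and each edge
    exactly once. *)
Lemma B_entry s s' :
  B y z s s' = if st_trans s s'
               then (if st_next s' then y else y^-1) * (if st_edge s' then z else 1)
               else 0.
Proof.
rewrite mxE.
by case: s => [[|[|[|[|[|[|//]]]]]] Hs]; case: s' => [[|[|[|[|[|[|//]]]]]] Hs'];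
  rewrite /= ?mulr1 1?mulrC.
Qed.

(** Allowed closed walks of states correspond to pairs (w, S). The factor y^N turns y^(men - women)
    into y^(2 men), which clears negative powers. *)
Lemma mxtrace_B_expr N : (0 < N)%N -> y != 0 ->
  y ^+ N * \tr (B y z ^+ N) =
  \sum_(p : {ffun 'I_N -> bool} * {set 'I_N} | no_three p.1 && edge_matching p.1 p.2)
    y ^+ (2 * #|[set i | p.1 i]|) * z ^+ #|p.2|.
Proof.
move=> N0 y0; rewrite mxtrace_expr_walk //.
pose good (f : {ffun 'I_N -> 'I_6}) := [forall i, st_trans (f i) (f (ordS i))].
pose wt (s : 'I_6) := (if st_next s then y else y^-1) * (if st_edge s then z else 1).
transitivity (y ^+ N * \sum_(f | good f) \prod_i wt (f (ordS i))).
  congr (_ * _); rewrite [RHS]big_mkcond /=; apply: eq_bigr => f _.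
  case: ifPn => [/forallP gf|/forallPn[i ngf]].
    by apply: eq_bigr => i _; rewrite B_entry gf.
  by rewrite (bigD1 i) //= B_entry (negPf ngf) mul0r.
pose h (p : {ffun 'I_N -> bool} * {set 'I_N}) : {ffun 'I_N -> 'I_6} :=
  [ffun i => state_of (p.1 i) (p.1 (ordS i)) (i \in p.2)].
pose h' (f : {ffun 'I_N -> 'I_6}) : {ffun 'I_N -> bool} * {set 'I_N} :=
  ([ffun i => st_sex (f i)], [set i | st_edge (f i)]).
rewrite (reindex_onto h h') /=; last first.
  move=> f /forallP gf; apply/ffunP => i; rewrite !ffunE inE.
  by have /and3P[/eqP <- _ _] := gf i; exact: state_of_st.
(* The condition [h' (h p) == p] excludes an edge of S between equal sexes, where [state_of] forgets
   its last bit. *)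
have okE p : good (h p) && (h' (h p) == p) = no_three p.1 && edge_matching p.1 p.2.
  case: p => w S /=; apply/andP/andP => [[/forallP g /eqP[hw hS]]|[/forallP t /forallP m]].
    have sexE i : st_sex (h (w, S) i) = w i by rewrite -[in RHS]hw !ffunE.
    have edgeE i : st_edge (h (w, S) i) = (i \in S) by rewrite -[in RHS]hS inE.
    have nextE i : st_next (h (w, S) i) = w (ordS i).
      by have /and3P[/eqP -> _ _] := g i.
    split; apply/forallP => i; have /and3P[_] := g i;
      rewrite ?sexE ?edgeE !nextE // => t m.
    by rewrite m andbT -edgeE -sexE -nextE st_edgeW.
  have hK i : [/\ st_sex (h (w, S) i) = w i, st_next (h (w, S) i) = w (ordS i)
                & st_edge (h (w, S) i) = (i \in S)].
    by rewrite ffunE; apply: state_ofK; have /andP[] := m i.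
  split.
    apply/forallP => i; rewrite /st_trans.
    have [-> -> ->] := hK i; have [-> -> ->] := hK (ordS i).
    by rewrite eqxx t /=; have /andP[] := m i.
  apply/eqP; congr (_, _); last by apply/setP => i; rewrite inE; have [] := hK i.
  by apply/ffunP => i; rewrite ffunE; have [] := hK i.
rewrite (eq_bigl _ _ okE) mulr_sumr; apply: eq_bigr => -[w S] /= /andP[_ /forallP m].
(* Rotating the cycle attaches each weight to its own state; a second rotation below moves from the
   next seat to the seat itself. *)
rewrite -(reindex_inj (@ordS_inj N) (P := xpredT) (F := fun i => wt (h (w, S) i))) /=.
have -> : \prod_i wt (h (w, S) i) =
    \prod_i (if w (ordS i) then y else y^-1) * \prod_i (if i \in S then z else 1).
  rewrite -big_split /=; apply: eq_bigr => i _.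
  rewrite /wt ffunE; have [|_ -> ->//] := @state_ofK (w i) (w (ordS i)) (i \in S).
  by have /andP[] := m i.
rewrite -(reindex_inj (@ordS_inj N) (P := xpredT) (F := fun i => if w i then y else y^-1)) /=.
rewrite -big_mkcond /= prodr_const mulrA; congr (_ * _).
(* One factor y per seat: a man then contributes y^2 and a woman y / y = 1. *)
have -> : y ^+ N = \prod_(i < N) y by rewrite prodr_const card_ord.
rewrite -big_split /= exprM -prodr_const [RHS]big_mkcond /=.
apply: eq_bigr => i _; rewrite inE.
by case: (w i); rewrite ?expr2 // divff.
Qed.

End Transfer.

(** * Seatings with prescribed sexes and couples *)

(** Induction on S: to add e, compose with the transposition of [rho (f e)] and [g e]. Injectivity
    of f and g keeps it away from the values already prescribed. *)
Lemma perm_extend (E T : finType) (S : {set E}) (f g : E -> T) :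
  {in S &, injective f} -> {in S &, injective g} ->
  exists rho : {perm T}, {in S, forall e, rho (f e) = g e}.
Proof.
have [n] := ubnP #|S|; elim: n S => // n IHn S.
have [->|/set0Pn[e eS]] := eqVneq S set0.
  by move=> _ _ _; exists 1%g => e; rewrite inE.
rewrite (cardsD1 e) eS add1n ltnS => leSn finj ginj.
have sub x : x \in S :\ e -> x \in S by rewrite in_setD1 => /andP[].
have [rho rhoP] : exists rho : {perm T}, {in S :\ e, forall x, rho (f x) = g x}.
  by apply: IHn => // x x' /sub ? /sub ?; [exact: finj|exact: ginj].
exists (rho * tperm (rho (f e)) (g e))%g => x xS; rewrite permM.
have [->|xe] := eqVneq x e; first by rewrite tpermL.
have xSe : x \in S :\ e by rewrite !inE xe.
rewrite (rhoP x) // tpermD //; apply: contraNneq xe => eq_ex; apply/eqP.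
  by apply: finj => //; apply: (perm_inj (s := rho)); rewrite rhoP.
exact: ginj.
Qed.

(** Right translation by [tau] maps the permutations supported off D onto those that agree with
    [tau] on D. *)
Lemma card_perm_agree (T : finType) (D : {set T}) (tau : {perm T}) :
  #|[set sigma : {perm T} | [forall c in D, sigma c == tau c]]| = (#|~: D|)`!.
Proof.
rewrite -card_perm -[RHS](card_imset _ (@mulIg _ tau)); apply: eq_card => sigma.
rewrite inE; apply/forall_inP/imsetP => [agree|[pi pi_on ->] c cD].
  exists (sigma * tau^-1)%g; last by rewrite mulgKV.
  apply/fintype.subsetP => c; rewrite !inE; apply: contra => cD.
  by rewrite permM (eqP (agree c cD)) permK.
by rewrite permM (out_perm pi_on) // inE negbK.
Qed.

Lemma inj_in_card_le (I C : finType) (c0 : C) (A : {set I}) :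
  (#|A| <= #|C|)%N -> exists f : I -> C, {in A &, injective f}.
Proof.
move=> leAC; exists (fun i => nth c0 (enum C) (index i (enum A))) => i j iA jA.
have lt x : x \in A -> (index x (enum A) < size (enum C))%N.
  move=> xA; rewrite -cardE; apply: leq_trans leAC.
  by rewrite cardE index_mem mem_enum.
move/eqP; rewrite nth_uniq ?lt ?enum_uniq // => /eqP ij.
by rewrite -(nth_index i (_ : i \in enum A)) ?mem_enum // ij nth_index ?mem_enum.
Qed.

Section MatchedSeatings.
Variables (I C E : finType) (w : {ffun I -> bool}) (S : {set E}).
Variables (mseat wseat : E -> I).
Hypothesis C_gt0 : (0 < #|C|)%N.
Hypothesis w_balanced : forall b, #|[set i | w i == b]| = #|C|.
Hypothesis mseatP : {in S, forall e, w (mseat e)}.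
Hypothesis wseatP : {in S, forall e, ~~ w (wseat e)}.
Hypothesis mseat_inj : {in S &, injective mseat}.
Hypothesis wseat_inj : {in S &, injective wseat}.

(** Injectivity within each sex, that is, injectivity of the seating that sends i to
    [(c i, w i)]. *)
Let class_inj (c : I -> C) := forall i j, w i = w j -> c i = c j -> i = j.

(** Number the men and the women separately, then permute the men's numbers by [perm_extend] so that
    they match the women's on S. *)
Let matched_base :
  exists2 c : I -> C, class_inj c & {in S, forall e, c (mseat e) = c (wseat e)}.
Proof.
have [c0 _] : exists c0 : C, c0 \in C by apply/card_gt0P.
have ex b : exists f : I -> C, {in [set i | w i == b] &, injective f}.
  by apply: (inj_in_card_le c0); rewrite w_balanced.
have [f fP] := ex true; have [g gP] := ex false.
have [|| rho rhoP] := @perm_extend _ _ S (f \o mseat) (g \o wseat).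
- move=> e e' eS e'S /fP; rewrite !inE !mseatP // => /(_ isT isT).
  exact: mseat_inj.
- move=> e e' eS e'S /gP; rewrite !inE !(negPf (wseatP _)) // => /(_ isT isT).
  exact: wseat_inj.
exists (fun i => if w i then rho (f i) else g i) => [i j wij|e eS].
  case wi: (w i); rewrite -wij wi; [move/perm_inj/fP|move/gP];
  by rewrite !inE -wij wi; apply.
by rewrite mseatP // (negPf (wseatP eS)); exact: rhoP.
Qed.

(** Each sex has as many seats as there are couples, so injectivity on it forces surjectivity. *)
Let class_inj_surj (c : I -> C) (b : bool) (x : C) :
  class_inj c -> exists2 i, w i = b & c i = x.
Proof.
move=> cinj.
have cE : c @: [set i | w i == b] = [set: C].
  apply/eqP; rewrite eqEcard subsetT cardsT card_in_imset ?w_balanced ?leqnn //.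
  by move=> i j; rewrite !inE => /eqP wi /eqP wj; apply: cinj; rewrite wi wj.
have : x \in c @: [set i | w i == b] by rewrite cE inE.
by case/imsetP => i; rewrite inE => /eqP wi ->; exists i.
Qed.

(** Each seating comes from the base one by a unique pair of relabellings, t of the men and u of the
    women. The couples on S force u = t on |S| labels: |C|! choices of t, then (|C| - |S|)! of u. *)
Lemma card_matched_seatings :
  #|[set s : {ffun I -> C * bool} |
     [&& injectiveb s, [forall i, (s i).2 == w i]
       & [forall e in S, (s (mseat e)).1 == (s (wseat e)).1]]]|
  = ((#|C|)`! * (#|C| - #|S|)`!)%N.
Proof.
have [c cinj cS] := matched_base.
pose relabel (p : {perm C} * {perm C}) : {ffun I -> C * bool} :=
  [ffun i => (if w i then p.1 (c i) else p.2 (c i), w i)].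
pose D := [set c (wseat e) | e in S].
have cardD : #|D| = #|S|.
  apply: card_in_imset => e e' eS e'S /cinj ee'.
  by apply: wseat_inj => //; apply: ee'; rewrite !(negPf (wseatP _)).
have relabel_inj : injective relabel.
  move=> [s t] [s' t'] /ffunP eq_st; congr (_, _); apply/permP => x.
    have [i wi <-] := class_inj_surj true x cinj.
    by have := eq_st i; rewrite !ffunE wi => -[].
  have [i wi <-] := class_inj_surj false x cinj.
  by have := eq_st i; rewrite !ffunE wi => -[].
pose P := [set p : {perm C} * {perm C} | [forall x in D, p.2 x == p.1 x]].
transitivity #|P|; last first.
  rewrite -sum1_card (eq_bigl (fun p : {perm C} * {perm C} =>
    true && (p.2 \in [set s : {perm C} | [forall x in D, s x == p.1 x]]))); last first.
    by move=> p; rewrite !inE.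
  rewrite -(pair_big_dep xpredT (fun t s : {perm C} =>
    s \in [set s' : {perm C} | [forall x in D, s' x == t x]]) (fun _ _ => 1%N)) /=.
  under eq_bigr do rewrite sum1_card card_perm_agree cardsCs setCK cardD.
  have card_permT : #|{perm C}| = (#|C|)`!.
    rewrite -[in RHS]cardsT -card_perm; apply: eq_card => s.
    by symmetry; apply/fintype.subsetP => x; rewrite inE.
  by rewrite sum_nat_const card_permT.
rewrite -[RHS](card_imset _ relabel_inj); apply: eq_card => s; rewrite inE.
apply/and3P/imsetP => [[/injectiveP sinj /forallP sw /forall_inP sS]|[[t u] tuP ->]].
  have sw' i : s i = ((s i).1, w i) by rewrite [LHS]surjective_pairing (eqP (sw i)).
  have part b : exists t : {perm C}, forall i, w i = b -> t (c i) = (s i).1.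
    (* [k x] is the seat of sex b that carries label x in the base seating; the relabelling sends x
       to the couple that s puts there. *)
    have [/= k wk ck] := fin_all_exists2 (fun x => class_inj_surj b x cinj).
    have k_inj : injective (fun x => (s (k x)).1).
      move=> x x' kxx'; rewrite -(ck x) -(ck x'); congr c; apply: sinj.
      by rewrite sw' [RHS]sw' kxx' !wk.
    exists (perm k_inj) => i wi; rewrite permE.
    by rewrite (_ : k (c i) = i) //; apply: cinj; rewrite ?wk ?ck.
  have [t tP] := part true; have [u uP] := part false.
  exists (t, u).
    rewrite inE; apply/forall_inP => _ /imsetP[e eS ->] /=.
    by rewrite uP ?(negPf (wseatP eS)) // -cS // tP ?mseatP // eq_sym sS.
  apply/ffunP => i; rewrite ffunE /= sw'; congr (_, _).
  by case wi: (w i); rewrite ?tP ?uP.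
split.
- apply/injectiveP => i j; rewrite !ffunE /= => -[+ wij].
  by rewrite -wij; case: ifP => _ /perm_inj; exact: cinj.
- by apply/forallP => i; rewrite ffunE.
- apply/forall_inP => e eS; rewrite !ffunE /= mseatP // (negPf (wseatP eS)) cS //.
  by rewrite eq_sym; move: tuP; rewrite inE => /forall_inP; apply; apply: imset_f.
Qed.

End MatchedSeatings.

(** The common index set of the seating count and of the trace coefficients of [B] and [B2]. *)
Definition seat_patterns n : {set {ffun 'I_(2 * n) -> bool} * {set 'I_(2 * n)}} :=
  [set p | [&& no_three p.1, edge_matching p.1 p.2 & #|[set i | p.1 i]| == n]].

(** S and its shift by one seat are disjoint and of equal size among 2n seats. Hence the
    natural-number difference n - |S| is never truncated. *)
Lemma edge_matching_card n (w : {ffun 'I_(2 * n) -> bool}) S :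
  edge_matching w S -> (#|S| <= n)%N.
Proof.
move=> /forallP m.
have dis : [disjoint S & [set ordS j | j in S]].
  apply/pred0P => i /=; apply/negP => /andP[iS /imsetP[j jS ij]].
  by have /andP[_] := m j; rewrite jS -ij iS.
have := subset_leq_card (fintype.subset_predT (S :|: [set ordS j | j in S])).
rewrite cardsU (disjoint_setI0 dis) cards0 subn0 card_imset ?card_ord; last exact: ordS_inj.
by rewrite addnn -mul2n leq_pmul2l.
Qed.

(** Two steps around a table of at most two seats lead back; with [1 < n] the two neighbours of a
    seat are distinct. *)
Lemma ordS_ordS_neq N (i : 'I_N) : (2 < N)%N -> ordS (ordS i) != i.
Proof.
move=> N2; apply/eqP => /(congr1 val) /=; have iN := ltn_ord i.
have [e|ne] := eqVneq i.+1 N.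
  by rewrite e modnn modn_small; lia.
have lt1 : (i.+1 < N)%N by lia.
rewrite (modn_small lt1).
have [e2|ne2] := eqVneq i.+2 N; first by rewrite e2 modnn; lia.
rewrite modn_small; lia.
Qed.

(** By cardinality an injective seating is a bijection onto the persons, n of each sex. *)
Lemma card_sex n (s : {ffun 'I_(2 * n) -> person n}) (b : bool) :
  injective s -> #|[set i | (s i).2 == b]| = n.
Proof.
move=> sinj.
have sT : s @: [set: 'I_(2 * n)] = [set: person n].
  apply/eqP; rewrite eqEcard subsetT cardsT card_imset //.
  by rewrite cardsT card_prod !card_ord card_bool mulnC leqnn.
have <- : #|s @: [set i | (s i).2 == b]| = #|[set i | (s i).2 == b]|.
  by rewrite card_imset.
have -> : s @: [set i | (s i).2 == b] = [set (x, b) | x in 'I_n].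
  apply/setP => -[x c]; apply/imsetP/imsetP => [[i + ->]|[x' _ [-> ->]]].
    by rewrite inE => /eqP <-; exists (s i).1 => //; rewrite -surjective_pairing.
  have : (x', b) \in s @: [set: 'I_(2 * n)] by rewrite sT inE.
  by case/imsetP => i _ si; exists i; rewrite ?inE -?si.
by rewrite card_imset ?card_ord // => x x' [].
Qed.

Section Counting.
Variables (n : nat) (w : {ffun 'I_(2 * n) -> bool}) (S : {set 'I_(2 * n)}).
Hypothesis n_gt1 : (1 < n)%N.

Definition matched_seatings : {set {ffun 'I_(2 * n) -> person n}} :=
  [set s : {ffun 'I_(2 * n) -> person n} |
    [&& injectiveb s, [forall i, (s i).2 == w i]
             & [forall i in S, spouses (s i) (s (ordS i))]]].

(** For a matching and a balanced pattern this is the count above; otherwise no seating exists, as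
    its sexes are balanced and its couples form a matching. *)
Lemma card_matched_seatings_edges :
  #|matched_seatings| =
  if edge_matching w S && (#|[set i | w i]| == n)
  then (n`! * (n - #|S|)`!)%N else 0%N.
Proof.
case: ifPn => [/andP[/forallP m /eqP wn]|bad].
  (* The man's end and the woman's end of an edge; [true] stands for a man. *)
  pose mseat e := if w e then e else ordS e.
  pose wseat e := if w e then ordS e else e.
  have mw e : e \in S -> w (ordS e) = ~~ w e.
    by move=> eS; have /andP[] := m e; rewrite eS /= => + _; case: (w e); case: (w _).
  have mS e : e \in S -> ordS e \notin S.
    by move=> eS; have /andP[_] := m e; rewrite eS.
  transitivity ((#|'I_n|)`! * (#|'I_n| - #|S|)`!)%N; last by rewrite card_ord.
  rewrite -(@card_matched_seatings _ _ _ w S mseat wseat) ?card_ord.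
  - apply: eq_card => s; rewrite !inE; congr (_ && _).
    case sw: [forall i, _] => //=; apply: eq_forallb_in => e eS.
    rewrite /spouses !(eqP (forallP sw _)) mw // /mseat /wseat.
    by case: (w e); rewrite ?andbT // eq_sym.
  - exact: ltnW.
  - case; first by rewrite -[RHS]wn; apply: eq_card => i; rewrite !inE eqb_id.
    have -> : [set i | w i == false] = ~: [set i | w i].
      by apply/setP => i; rewrite !inE eqbF_neg.
    by rewrite cardsCs setCK wn card_ord mul2n -addnn addnK.
  - by move=> e eS; rewrite /mseat; case: ifP => // we; rewrite mw ?we.
  - by move=> e eS; rewrite /wseat; case: ifPn => // we; rewrite mw ?we.
  (* Distinct edges with a common end would be consecutive, which [mS] forbids. *)
  - move=> e e' eS e'S; rewrite /mseat; case: ifP => _; case: ifP => _ // ee'.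
    + by move: (mS _ e'S); rewrite -ee' eS.
    + by move: (mS _ eS); rewrite ee' e'S.
    + exact: ordS_inj ee'.
  - move=> e e' eS e'S; rewrite /wseat; case: ifP => _; case: ifP => _ // ee'.
    + exact: ordS_inj ee'.
    + by move: (mS _ eS); rewrite ee' e'S.
    + by move: (mS _ e'S); rewrite -ee' eS.
apply/eqP; rewrite cards_eq0; apply/eqP/setP => s; rewrite !inE.
apply/negP => /and3P[/injectiveP sinj /forallP sw /forall_inP sS].
case/negP: bad; apply/andP; split; last first.
  rewrite -[X in _ == X](card_sex true sinj); apply/eqP/eq_card => i.
  by rewrite !inE (eqP (sw i)) eqb_id.
apply/forallP => i; apply/andP; split.
  by apply/implyP => /sS /andP[_]; rewrite (eqP (sw _)) (eqP (sw _)).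
(* If two consecutive edges hold couples, the spouse's spouse sits two seats ahead and is the same
   person, against injectivity. *)
apply/negP => /andP[/sS /andP[/eqP e1 s1] /sS /andP[/eqP e2 s2]].
have : s (ordS (ordS i)) = s i.
  rewrite [LHS]surjective_pairing [RHS]surjective_pairing -e2 -e1; congr (_, _).
  by move: s1 s2; case: (s _).2; case: (s _).2; case: (s _).2.
by move/sinj/eqP; apply/negP/ordS_ordS_neq; lia.
Qed.

End Counting.

(** * Inclusion-exclusion *)

(** Expansion of the product of the factors 1 - [a i], with S the set of factors from which -[a i]
    is taken. *)
Lemma prodr_negb_incl_excl (R : comNzRingType) (I : finType) (a : I -> bool) :
  \prod_i (~~ a i)%:R = \sum_(S : {set I} | [forall i in S, a i]) (-1) ^+ #|S| :> R.
Proof.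
transitivity (\prod_i (- (a i)%:R + 1) : R).
  by apply: eq_bigr => i _; case: (a i); rewrite ?addNr ?oppr0 ?add0r.
rewrite bigA_distr /= [RHS]big_mkcond /=; apply: eq_bigr => S _.
case: ifPn => [/forall_inP Sa|/forall_inPn[i iS nai]].
  rewrite -prodr_const [RHS]big_mkcond /=; apply: eq_bigr => i _.
  by case: ifP => // /Sa ->.
by rewrite (bigD1 i) //= iS (negPf nai) oppr0 mul0r.
Qed.

Lemma seatingsE (R : comNzRingType) (n : nat) : (1 < n)%N ->
  (seatings n)%:R = \sum_(p in seat_patterns n)
    (-1) ^+ #|p.2| * (n`! * (n - #|p.2|)`!)%:R :> R.
Proof.
move=> n_gt1; pose sex (s : {ffun 'I_(2 * n) -> person n}) := [ffun i => (s i).2].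
pose sp (s : {ffun 'I_(2 * n) -> person n}) i := spouses (s i) (s (ordS i)).
rewrite /seatings -sum1_card natr_sum /=.
transitivity (\sum_(s : {ffun 'I_(2 * n) -> person n} | injectiveb s && no_three (sex s))
    \sum_(S : {set 'I_(2 * n)} | [forall i in S, sp s i]) (-1) ^+ #|S| : R).
  rewrite [LHS]big_mkcond [RHS]big_mkcond /=; apply: eq_bigr => s _.
  rewrite inE /admissible -prodr_negb_incl_excl.
  set t := [forall i, ~~ (((s i).2 == _) && _)].
  have -> : no_three (sex s) = t by apply: eq_forallb => i; rewrite !ffunE.
  case: (injectiveb s) => //=; case: t; rewrite ?andbT ?andbF //.
  case: ifPn => [/forallP nsp|/forallPn[i nsp]].
    by rewrite big1 // => i _; rewrite nsp.
  by rewrite (bigD1 i) //= (negPf nsp) mul0r.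
transitivity (\sum_(p : {ffun 'I_(2 * n) -> bool} * {set 'I_(2 * n)} | no_three p.1)
   (-1) ^+ #|p.2| * #|matched_seatings p.1 p.2|%:R : R).
  (* Group the seatings by sex pattern, then exchange the sum over seatings with the sum over S. *)
  rewrite (partition_big sex (fun w => no_three w)) /=; last by move=> s /andP[].
  rewrite [RHS](eq_bigl (fun p => no_three p.1 && true)); last first.
    by move=> p; rewrite andbT.
  rewrite -(pair_big_dep (fun w : {ffun 'I_(2 * n) -> bool} => no_three w)
    (fun _ (_ : {set 'I_(2 * n)}) => true)
    (fun w S => (-1) ^+ #|S| * #|matched_seatings w S|%:R)) /=.
  apply: eq_bigr => w w3.
  rewrite (exchange_big_dep xpredT) //=; apply: eq_bigr => S _.
  rewrite sumr_const mulr_natr; congr (_ *+ _); apply: eq_card => s.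
  rewrite !inE unfold_in /=.
  have -> : [forall i, (s i).2 == w i] = (sex s == w).
    by apply/forallP/eqP => [sw|<- i]; rewrite ?ffunE //;
      apply/ffunP => i; rewrite ffunE; apply/eqP.
  by have [->|_] := eqVneq (sex s) w; rewrite ?w3 ?andbT ?andbF.
(* Pairs outside [seat_patterns] contribute 0, since no seating realises them. *)
rewrite [RHS]big_mkcond [LHS]big_mkcond /=; apply: eq_bigr => -[w S] _ /=.
rewrite card_matched_seatings_edges // inE /=.
by case: ifP => //= _; case: ifP => //= _; rewrite mulr0.
Qed.

(** * Trace coefficients of [B] and [B2] as sums over patterns *)

Lemma mxtrace_B_expr_coef (n : nat) : (0 < n)%N ->
  laurent_coef 0 (\tr (B fracy fracz ^+ (2 * n))) =
  \sum_(p in seat_patterns n) 'X^#|p.2| :> {poly int}.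
Proof.
move=> n0.
pose q : {poly {poly int}} := \sum_(p : {ffun 'I_(2 * n) -> bool} * {set 'I_(2 * n)} |
   no_three p.1 && edge_matching p.1 p.2) 'X^(2 * #|[set i | p.1 i]|) * ('X^#|p.2|)%:P.
have trE : \tr (B fracy fracz ^+ (2 * n)) * tofrac 'X ^+ (2 * n) = tofrac q.
  rewrite mulrC [LHS]mxtrace_B_expr ?muln_gt0 //; last first.
    by rewrite tofrac_eq0 polyX_eq0.
  rewrite /q raddf_sum /=; apply: eq_bigr => p _.
  by rewrite tofracM !rmorphXn /=.
(* Degree 0 in y becomes degree 2n after clearing denominators, which selects the patterns with
   exactly n men. *)
rewrite (laurent_coefE _ trE) addr0 /q coef_sum big_mkcond [RHS]big_mkcond /=.
apply: eq_bigr => -[w S] _; rewrite inE /= coefMC coefXn eqn_pmul2l //.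
by case: (no_three w) => //=; case: (edge_matching w S) => //=;
  rewrite eq_sym; case: eqP; rewrite ?mul1r ?mul0r.
Qed.

(** Two steps of [B] at z = -1/t make one step of [B2]; after n of them the factor t^n turns z^j
    into (-1)^j t^(n-j). *)
Lemma B2_sqrB (K : fieldType) (y t : K) : y != 0 -> t != 0 ->
  B2 (y ^+ 2) t = (y ^+ 2 * t) *: B y (- t^-1) ^+ 2.
Proof.
move=> y0 t0; apply/matrixP => i j; rewrite expr2 !mxE.
rewrite !big_ord_recl big_ord0 !mxE.
case: i => [[|[|[|[|[|[|//]]]]]] Hi];
 case: j => [[|[|[|[|[|[|//]]]]]] Hj]; rewrite /=.
all: by field; rewrite ?y0 ?t0.
Qed.

Lemma mxtrace_exprZ (K : comNzRingType) m (c : K) (M : 'M[K]_m.+1) k :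
  \tr ((c *: M) ^+ k) = c ^+ k * \tr (M ^+ k).
Proof. by rewrite exprZn mxtraceZ. Qed.

Lemma mxtrace_B2_sqr_expr (K : fieldType) (y t : K) n : y != 0 -> t != 0 ->
  \tr (B2 (y ^+ 2) t ^+ n) =
  (y ^+ 2 * t) ^+ n * \tr (B y (- t^-1) ^+ (2 * n)).
Proof. by move=> y0 t0; rewrite B2_sqrB // mxtrace_exprZ exprM. Qed.

(** The link with [B] needs y^2 and inverses, so y^2 is substituted for y and the polynomials are
    compared in the fraction field. *)
Lemma mxtrace_B2_expr_coef (R : idomainType) (n : nat) : (0 < n)%N ->
  (\tr (B2 'X ('X%:P : {poly {poly R}}) ^+ n))`_n =
  \sum_(p in seat_patterns n) (-1) ^+ #|p.2| *: 'X^(n - #|p.2|).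
Proof.
move=> n0; set p := \tr _.
pose q : {poly {poly R}} := \sum_(p : {ffun 'I_(2 * n) -> bool} * {set 'I_(2 * n)} |
   no_three p.1 && edge_matching p.1 p.2)
   'X^(2 * #|[set i | p.1 i]|) * ((-1) ^+ #|p.2| *: 'X^(n - #|p.2|))%:P.
have pXn : p \Po 'X^2 = q.
  apply/eqP; rewrite -tofrac_eq; apply/eqP.
  (* [Y] and [T] are abstracted because unification diverges on [tofrac 'X]. *)
  have [Y YE] : exists Y, Y = tofrac ('X : {poly {poly R}}) by eexists.
  have [T TE] : exists T, T = tofrac ('X%:P : {poly {poly R}}) by eexists.
  have Y0 : Y != 0 by rewrite YE tofrac_eq0 polyX_eq0.
  have T0 : T != 0 by rewrite TE tofrac_eq0 polyC_eq0 polyX_eq0.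
  have -> : tofrac (p \Po 'X^2) = \tr (B2 (Y ^+ 2) T ^+ n).
    have -> : p \Po 'X^2 = \tr (B2 'X^2 'X%:P ^+ n).
      by rewrite (rmorph_mxtrace_B2_expr (comp_poly 'X^2)) /= comp_polyX comp_polyC.
    by rewrite rmorph_mxtrace_B2_expr /= rmorphXn YE TE.
  rewrite (mxtrace_B2_sqr_expr n Y0 T0).
  rewrite exprMn -exprM mulrAC mxtrace_B_expr ?muln_gt0 //.
  rewrite mulr_suml raddf_sum /=.
  apply: eq_bigr => -[w S] /= /andP[_ /edge_matching_card leSn].
  rewrite tofracM -mul_polyC !polyCM tofracM !rmorphXn /= !rmorphN1 -YE -TE -mulrA.
  (* What remains is (-1/T)^|S| T^n = (-1)^|S| T^(n - |S|), valid because |S| is at most n. *)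
  congr (_ * _); rewrite -[- T^-1]mulN1r exprMn exprVn -mulrA; congr (_ * _).
  by rewrite (_ : T ^+ n = T ^+ #|S| * T ^+ (n - #|S|)) ?mulKf ?expf_neq0 //
    -exprD subnKC.
(* Degree n of [p] is degree 2n of its composite with y^2. *)
have := congr1 (fun r : {poly {poly R}} => r`_(2 * n)) pXn.
rewrite coef_comp_poly_Xn // dvdn_mulr // mulKn // => ->.
rewrite /q coef_sum big_mkcond [RHS]big_mkcond /=.
apply: eq_bigr => -[w S] _; rewrite inE /= coefMC coefXn eqn_pmul2l //.
by case: (no_three w) => //=; case: (edge_matching w S) => //=;
  rewrite eq_sym; case: eqP; rewrite ?mul1r ?mul0r.
Qed.

(** * Derivation of the three formulas *)

Theorem theorem2 (R : realType) (n : nat) (hn : (1 < n)%N) :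
  [/\ (seatings n)%:Z =
        n`!%:Z * \sum_(j < n.+1) (-1) ^+ j * (n - j)`!%:Z *
                   (laurent_coef 0 (\tr (B fracy fracz ^+ (2 * n))))`_j,
      ((seatings n)%:R%:E =
        n`!%:R%:E * \int[lebesgue_measure]_(t in `[0%R, +oo[)
          (((\tr (B2 'X ('X%:P : {poly {poly R}}) ^+ n))`_n).[t]
             * expR (- t))%:E)%E &
      ((seatings n)%:R%:E =
        n`!%:R%:E * \int[lebesgue_measure]_(t in `[0%R, +oo[)
          ((ratfps R n n).[t] * expR (- t))%:E)%E].
Proof.
have n0 : (0 < n)%N by exact: ltnW.
have ii : ((seatings n)%:R%:E =
    n`!%:R%:E * \int[lebesgue_measure]_(t in `[0%R, +oo[)
      (((\tr (B2 'X ('X%:P : {poly {poly R}}) ^+ n))`_n).[t]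
         * expR (- t))%:E)%E.
  (* Integration replaces t^(n - |S|) by (n - |S|)!, which gives the inclusion-exclusion sum. *)
  rewrite mxtrace_B2_expr_coef // integral_sum_monomials_expRN -EFinM seatingsE //.
  rewrite mulr_sumr; congr (_%:E); apply: eq_bigr => p _.
  by rewrite natrM mulrCA.
split=> //; last by rewrite ii ratfps_coef.
rewrite -[LHS]natz seatingsE // mxtrace_B_expr_coef //.
under [in RHS]eq_bigr do rewrite coef_sum mulr_sumr.
rewrite exchange_big mulr_sumr /=; apply: eq_bigr => -[w S] /=.
rewrite inE /= => /and3P[_ /edge_matching_card leSn _].
(* Only j = |S| picks a nonzero coefficient of X^|S|, and |S| <= n puts it in range. *)
rewrite (bigD1 (Ordinal (leSn : (#|S| < n.+1)%N))) //= big1 => [|j jS].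
  by rewrite coefXn eqxx mulr1 addr0 natrM [RHS]mulrCA !natz.
by rewrite coefXn (negPf (_ : j != #|S| :> nat)) ?mulr0.
Qed.
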